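(* The following problem is solvable in polynomial time: given a $(2,1)$-polar graph $G$ in which every clique has size at least 3, decide whether $G$ admits a 2-clique-colouring.
   Context: Graphs are finite and simple. A clique of a graph is a maximal set of vertices of size at least 2 inducing a complete graph. A 2-clique-colouring is a colouring of the vertices with at most 2 colours such that no clique is monochromatic. A graph $G$ is $(2,1)$-polar if $V(G)$ can be partitioned into sets $A$ and $B$ such that $B$ induces a complete graph and every connected component of $G[A]$ is a complete graph on at most 2 vertices. *)

(* Defs.v *)
From mathcomp Require Import all_boot.

Set Implicit Arguments.
Unset Strict Implicit.
Unset Printing Implicit Defensive.

Record sgraph := SGraph {
  vertex :> finType;
  adj : rel vertex;
  adj_sym : symmetric adj;
  adj_irr : irreflexive adj
}.

Section Graphs.
Variable G : sgraph.
Implicit Types (A B K : {set G}) (x y : G).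

Definition complete K : bool :=
  [forall x in K, forall y in K, (x != y) ==> adj x y].

(* Cliques are inclusion-maximal; isolated vertices are not cliques. *)
Definition clique K : bool := (2 <= #|K|) && maxset complete K.

Definition monochromatic k (f : {ffun G -> 'I_k}) K : Prop :=
  exists c : 'I_k, forall x, x \in K -> f x = c.

Definition clique_colouring k (f : {ffun G -> 'I_k}) : Prop :=
  forall K, clique K -> ~ monochromatic f K.

Definition clique_colourable k : Prop :=
  exists f : {ffun G -> 'I_k}, clique_colouring f.

Definition induced_adj A : rel G := [rel x y | [&& x \in A, y \in A & adj x y]].

(* The component of x in G[A]; meaningful only when x \in A. *)
Definition component A x : {set G} := [set y | connect (induced_adj A) x y].

(* Either part of the partition may be empty. *)
Definition polar21 : Prop :=
  exists A B : {set G},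
    [/\ A :|: B = [set: G], A :&: B = set0, complete B
      & forall x, x \in A -> complete (component A x) /\ #|component A x| <= 2].

Definition cliques_ge3 : Prop := forall K, clique K -> 3 <= #|K|.

End Graphs.

Inductive move := MoveLeft | MoveRight | NoMove.

(* Deterministic one-tape Turing machines over the input alphabet bool. A tape
   symbol is None (blank), Some (inl b) (input symbol), or Some (inr a) (further
   symbol of the machine). tm_halt q is Some true in accepting states, Some false
   in rejecting states, and None in non-halting states. *)
Record tm := TM {
  tm_state : finType;
  tm_extra : finType;
  tm_start : tm_state;
  tm_halt : tm_state -> option bool;
  tm_trans : tm_state -> option (bool + tm_extra) ->
             tm_state * option (bool + tm_extra) * move
}.

Section Machine.
Variable M : tm.

Definition tm_symbol : Type := option (bool + tm_extra M).

(* The tape is infinite in both directions: conf_left lists the cells to the left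
   of the head, nearest first; conf_right lists the scanned cell and those to its
   right; all cells not listed are blank. *)
Record conf := Conf {
  conf_state : tm_state M;
  conf_left : seq tm_symbol;
  conf_right : seq tm_symbol
}.

Definition init_conf (w : seq bool) : conf :=
  Conf (tm_start M) [::] [seq Some (inl b) | b <- w].

Definition step (c : conf) : conf :=
  let: Conf q l r := c in
  if tm_halt q is Some _ then c else
  let: (q', s, m) := tm_trans q (head None r) in
  match m with
  | MoveLeft => Conf q' (behead l) [:: head None l, s & behead r]
  | MoveRight => Conf q' (s :: l) (behead r)
  | NoMove => Conf q' l (s :: behead r)
  end.

Definition outcome (w : seq bool) (t : nat) : option bool :=
  tm_halt (conf_state (iter t step (init_conf w))).

End Machine.

(* The adjacency matrix, row by row, for the vertex order given by enum. *)
Definition encode (G : sgraph) : seq bool :=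
  [seq adj x y | x <- enum G, y <- enum G].

(* Deciding Q for input graphs that are guaranteed to satisfy the restriction R;
   the machine is given the graph only, and nothing is required on other inputs. *)
Definition poly_time_decidable (R Q : sgraph -> Prop) : Prop :=
  exists (M : tm) (c k : nat), forall G : sgraph, R G ->
    exists (t : nat) (b : bool),
      [/\ t <= c * size (encode G) ^ k + c,
          outcome M (encode G) t = Some b
        & b = true <-> Q G].

(* Main.v *)
(** The answer is always "yes", so the machine that accepts at once is correct.
    Let [A], [B] witness polarity.  Every 2-colouring of [B] that is not constant
    on [B] (when [B] is a clique) extends to [A]: a vertex of [A] whose
    neighbourhood in [B] is monochromatic gets the opposite colour, and two
    adjacent vertices of [A] that both see two colours in [B] get different
    colours.  A clique meeting [A] in one vertex [a] consists of [a] and all its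
    neighbours in [B], while a clique containing two vertices of [A] has, by the
    size hypothesis, a further vertex in [B]; neither can be monochromatic. *)
Require Import Defs.
From mathcomp Require Import all_boot.

Set Implicit Arguments.
Unset Strict Implicit.
Unset Printing Implicit Defensive.

Section Cliques.
Variable G : sgraph.
Implicit Types (A B K S : {set G}) (x y z : G).

Lemma completeP K :
  reflect {in K &, forall x y, x != y -> adj x y} (complete K).
Proof.
apply: (iffP forall_inP) => [cK x y xK yK | cK x xK].
  by move/forall_inP: (cK x xK) => /(_ y yK) /implyP.
by apply/forall_inP => y yK; apply/implyP; apply: cK.
Qed.

Lemma clique_adj K x y :
  clique K -> x \in K -> y \in K -> x != y -> adj x y.
Proof. by case/andP=> _ /maxsetp /completeP cK; apply: cK. Qed.

Lemma clique_eq_super K S : clique K -> complete S -> K \subset S -> S = K.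
Proof. by case/andP=> _ /maxsetP[_ maxK] cS /maxK; apply. Qed.

(** Adding [y] to [K] keeps the set complete, so maximality forces [y] to be in [K] already. *)
Lemma clique_closed K y :
  clique K -> {in K, forall x, x != y -> adj x y} -> y \in K.
Proof.
move=> cK adjy; rewrite -(@clique_eq_super K (y |: K)) ?setU11 ?subsetUr //.
apply/completeP => u v /setU1P[->|uK] /setU1P[->|vK] => [|neq|neq|neq].
- by rewrite eqxx.
- by rewrite adj_sym adjy // eq_sym.
- exact: adjy.
- exact: (clique_adj cK).
Qed.

Lemma exists_outside K S :
  #|S| < #|K| -> exists2 z, z \in K & z \notin S.
Proof.
by move=> ltSK; apply/subsetPn; apply: contraL ltSK => /subset_leq_card; rewrite -leqNgt.
Qed.

(** Otherwise [x], [y] and [z] would be three distinct vertices of one component. *)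
Lemma small_component_nbr_unique A x y z :
  #|component A x| <= 2 -> x \in A -> y \in A -> z \in A ->
  adj x y -> adj x z -> y = z.
Proof.
move=> le2 xA yA zA axy axz; apply: contraTeq le2 => neq_yz; rewrite -ltnNge.
have nbr_neq u : adj x u -> x != u by apply: contraTneq => ->; rewrite adj_irr.
have <-: #|[set x; y; z]| = 3.
  by rewrite -setUA cardsU1 cards2 !inE !negb_or !nbr_neq // neq_yz.
apply/subset_leq_card/subsetP => u; rewrite !inE -orbA.
case/or3P=> /eqP->; first exact: connect0.
  by apply: connect1; apply/and3P.
by apply: connect1; apply/and3P.
Qed.

Section Extension.
Variables (A B : {set G}) (h : pred G).

Let sees (c : bool) x := [exists y in B, adj x y && (h y == c)].

(** The order [enum_rank] breaks ties: on an edge of [G[A]] whose ends both see two colours, only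
    the end of lower rank gets [true]. A vertex of [A] without neighbours in [B] gets [true]. *)
Definition extend_colouring x : bool :=
  if x \in B then h x
  else if sees true x && sees false x
    then [exists y in A, adj x y && (enum_rank x < enum_rank y)]
    else ~~ sees true x.

Hypothesis coverAB : A :|: B = setT.
Hypothesis disjAB : A :&: B = set0.
Hypothesis nbr_uniqueA :
  {in A & &, forall x y z, adj x y -> adj x z -> y = z}.

Let notinB x : x \in A -> x \notin B.
Proof. by move=> xA; apply: contra_eqN disjAB => xB; apply/set0Pn; exists x; apply/setIP. Qed.

Let inB x : x \notin A -> x \in B.
Proof. by have := in_setT x; rewrite -coverAB inE => /orP[->|]. Qed.

(** A vertex of [A] that sees a single colour avoids it, so agreeing with a neighbour in [B] is
    possible only in the tie-breaking case. *)
Let sees_both x z : x \in A -> z \in B -> adj x z ->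
  extend_colouring x = h z -> sees true x /\ sees false x.
Proof.
move=> xA zB axz; rewrite /extend_colouring (negPf (notinB xA)).
have: sees (h z) x by apply/exists_inP; exists z; rewrite ?axz ?eqxx.
by case: (h z) => ->; case: (sees _ x).
Qed.

Lemma extend_colouring_not_constant K (c : bool) :
  complete B -> clique K -> 3 <= #|K| ->
  (clique B -> exists y z, [/\ y \in B, z \in B & h y != h z]) ->
  ~ {in K, forall x, extend_colouring x = c}.
Proof.
move=> cB cK K3 hB constK.
have hK z : z \in K -> z \in B -> h z = c.
  by move=> zK zB; rewrite -(constK z zK) /extend_colouring zB.
have [/exists_inP[x xK xA] | noA] := boolP [exists x in K, x \in A]; last first.
  have sKB : K \subset B.
    by apply/subsetP => x xK; apply/inB; apply: contra noA => xA; apply/exists_inP; exists x.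
  (* A clique inside [B] is [B] itself, and [h] is not constant there. *)
  have eqBK := clique_eq_super cK cB sKB; move: hB; rewrite eqBK.
  by case=> // y [z [yK zK]]; rewrite !hK ?eqxx // (subsetP sKB).
have [/exists_inP[y yK /andP[yA neq_xy]] | one] :=
  boolP [exists y in K, (y \in A) && (x != y)].
- have axy := clique_adj cK xK yK neq_xy.
  have [|z zK] := @exists_outside K [set x; y]; first by rewrite cards2 neq_xy.
  rewrite !inE negb_or => /andP[neq_zx neq_zy].
  have axz : adj x z by apply: (clique_adj cK); rewrite // eq_sym.
  have ayz : adj y z by apply: (clique_adj cK); rewrite // eq_sym.
  have zB : z \in B.
    apply/inB; apply: contra neq_zy => zA.
    by rewrite (nbr_uniqueA xA zA yA axz axy).
  (* Since [z] shares the colour [c], both ends of the edge fall under the tie-break. Applied in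
     both directions, this makes two opposite strict comparisons of ranks equal. *)
  have rank_colour u v : u \in K -> u \in A -> v \in A -> adj u v -> adj u z ->
      c = (enum_rank u < enum_rank v).
    move=> uK uA vA auv auz; rewrite -(constK u uK).
    have [|t f] := @sees_both u z uA zB auz; first by rewrite constK ?hK.
    rewrite /extend_colouring (negPf (notinB uA)) t f /=.
    apply/exists_inP/idP => [[w wA /andP[auw]] | lt_uv].
      by rewrite (nbr_uniqueA uA wA vA auw auv).
    by exists v; rewrite ?auv.
  have cxy := rank_colour x y xK xA yA axy axz.
  have := rank_colour y x yK yA xA; rewrite adj_sym => /(_ axy ayz).
  rewrite cxy; case: ltngtP => // /val_inj /enum_rank_inj eq_xy.
  by rewrite eq_xy eqxx in neq_xy.
have restB z : z \in K -> x != z -> z \in B.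
  move=> zK neq; apply/inB; apply: contra one => zA.
  by apply/exists_inP; exists z; rewrite ?zA.
(* Apart from [x], all of [K] lies in the complete set [B], so [K] absorbs every neighbour of [x] in
   [B], including one of each colour. *)
have nbrK z : z \in B -> adj x z -> z \in K.
  move=> zB axz; apply: (clique_closed cK) => u uK neq_uz.
  have [-> // | neq_xu] := eqVneq u x.
  by move/completeP: cB; apply=> //; rewrite restB 1?eq_sym.
have [|z zK] := @exists_outside K [set x]; first by rewrite cards1 ltnW.
rewrite inE eq_sym => neq_xz.
have zB := restB z zK neq_xz; have axz := clique_adj cK xK zK neq_xz.
have [|] := @sees_both x z xA zB axz; first by rewrite constK ?hK.
move=> /exists_inP[u uB /andP[axu /eqP hu]] /exists_inP[v vB /andP[axv /eqP hv]].
by have := hK v (nbrK v vB axv) vB; rewrite -(hK u (nbrK u uB axu) uB) hu hv.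
Qed.

End Extension.

Lemma clique_colourable2 (g : pred G) :
  (forall K c, clique K -> ~ {in K, forall x, g x = c}) -> clique_colourable G 2.
Proof.
move=> gP; exists [ffun x => if g x then ord_max else ord0] => K cK [i constK].
apply: (gP K (i == ord_max) cK) => x /constK.
by rewrite ffunE => <-; case: (g x).
Qed.

Lemma polar21_colourable :
  polar21 G -> cliques_ge3 G -> clique_colourable G 2.
Proof.
case=> A [B [coverAB disjAB cB compA]] ge3.
have [h hB] : exists h : pred G,
    clique B -> exists y z, [/\ y \in B, z \in B & h y != h z].
  have [-> | [b bB]] := set_0Vmem B; first by exists predT; rewrite /clique cards0.
  (* Singling out one vertex suffices, as [B], when a clique, has another one. *)
  exists (pred1 b) => /ge3/ltnW B2.
  have [|z zB] := @exists_outside B [set b]; first by rewrite cards1.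
  by rewrite inE => neq; exists b, z; rewrite /= eqxx (negPf neq).
apply: (@clique_colourable2 (extend_colouring A B h)) => K c cK.
apply: extend_colouring_not_constant => // [x y z xA yA zA|]; last exact: ge3.
by apply: (@small_component_nbr_unique A) => //; case: (compA x xA).
Qed.

End Cliques.

Definition accepting_tm : tm :=
  @TM unit void tt (fun=> Some true) (fun q s => (q, s, NoMove)).

Theorem theorem8 :
  poly_time_decidable
    (fun G : sgraph => polar21 G /\ cliques_ge3 G)
    (fun G : sgraph => clique_colourable G 2).
Proof.
(* The start state already accepts, so time 0 meets even the zero bound. *)
exists accepting_tm, 0, 0 => G [polarG ge3]; exists 0, true; split=> //.
by split=> // _; apply: polar21_colourable.
Qed.
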